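(* Let $T$ be a directed tree on $k$ vertices. Then for every finite directed graph $H$, $$\hom(T,H)\;\le\;\max\{\hom(S_{0,k-1},H),\ \hom(S_{k-1,0},H)\}.$$
   Context: A digraph (directed graph) is a finite directed simple loopless graph: there is at most one arc for each ordered pair of distinct vertices (a pair of opposite arcs $u\to v$, $v\to u$ is allowed). A directed tree is an orientation of a finite undirected tree (each edge receives exactly one direction). $\hom(D,H)$ is the number of digraph homomorphisms $D\to H$, i.e. maps $\varphi:V(D)\to V(H)$ such that $\varphi(u)\to\varphi(v)$ is an arc of $H$ whenever $u\to v$ is an arc of $D$. For integers $a,b\ge 0$, $S_{a,b}$ is the directed star with a centre vertex and $a+b$ leaves, with $a$ arcs directed from a leaf into the centre and $b$ arcs directed from the centre to a leaf; thus $S_{k-1,0}$ and $S_{0,k-1}$ are the two pure stars on $k$ vertices. *)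

(* Defs.v *)
From HB Require Import structures.
From mathcomp Require Import all_boot.

Set Implicit Arguments.
Unset Strict Implicit.
Unset Printing Implicit Defensive.

Record digraph := Digraph {
  vertex : finType;
  arc : rel vertex;
  arc_irrefl : irreflexive arc
}.

Definition is_hom (D H : digraph) (f : {ffun vertex D -> vertex H}) : bool :=
  [forall u, forall v, arc u v ==> arc (f u) (f v)].

Definition hom (D H : digraph) : nat :=
  #|[set f : {ffun vertex D -> vertex H} | is_hom f]|.

(* In a simple graph every edge x y yields the closed walk [:: x; y], which
   satisfies [ucycle]; genuine cycles are those with at least 3 vertices. *)
Definition acyclic (V : finType) (e : rel V) : Prop :=
  forall c : seq V, 2 < size c -> ~ ucycle e c.

Definition undirected_tree (V : finType) (e : rel V) : Prop :=
  [/\ symmetric e, irreflexive e, 0 < #|V|,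
      (forall x y : V, connect e x y) & acyclic e].

Definition orientation_of (V : finType) (e d : rel V) : Prop :=
  (forall x y : V, e x y = d x y || d y x) /\
  (forall x y : V, ~~ (d x y && d y x)).

Definition directed_tree (D : digraph) : Prop :=
  exists e : rel (vertex D), undirected_tree e /\ orientation_of e (@arc D).

(* The centre is [None]; the leaves [Some (inl i)] are the [a] in-neighbours of
   the centre and the leaves [Some (inr j)] are its [b] out-neighbours. *)
Definition star_arc (a b : nat) : rel (option ('I_a + 'I_b)) :=
  fun x y => match x, y with
             | Some (inl _), None => true
             | None, Some (inr _) => true
             | _, _ => false
             end.

Lemma star_arc_irrefl (a b : nat) : irreflexive (@star_arc a b).
Proof. by case=> [[i|j]|]. Qed.

Definition star (a b : nat) : digraph := Digraph (@star_arc_irrefl a b).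

(* Main.v *)
Require Import Defs.
From HB Require Import structures.
From mathcomp Require Import all_boot zify.

(** Write d+ and d- for the out- and in-degree in H, and n for the number of
    edges of T.  The two stars on the right have sum_x d+(x)^n and
    sum_x d-(x)^n homomorphisms ([hom_star]), so the theorem bounds hom(T, H)
    by the larger of these two power sums.

    The induction needs a power of a degree at one distinguished vertex v: for
    a tree with m edges,
      sum over homs f of d(f v)^A  <=  max of sum d+^(A+m) and sum d-^(A+m),
    where d is d+ or d-.  If m > 0, the tree has a leaf u other than v; let w be
    its neighbour.  Once the rest of f is fixed, the number of choices for f u
    is d'(f w), where d' is d+ or d- according to the direction of the edge, so
    the sum becomes the sum of d(f v)^A * d'(f w) over the smaller tree
    ([remove_leaf]).  By the weighted AM-GM inequality
      (A+1) x^A y <= A x^(A+1) + y^(A+1)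
    this is at most a convex combination of two sums with exponent A+1, one
    with distinguished vertex v and the other with w, and the induction
    hypothesis bounds both by the same maximum ([rooted_count_le]).  Choosing
    the leaf away from v at every step keeps the factor d(f v)^A intact, and
    the same holds after the distinguished vertex has moved to w.

    Subtrees are represented by vertex sets S, and partial maps by total maps
    T -> H constrained only on S.  Each vertex outside S then contributes a
    free factor #|H|, which the powers of #|H| in [rooted_count_le] balance. *)

Set Implicit Arguments.
Unset Strict Implicit.
Unset Printing Implicit Defensive.

(* [path] also exports an [arc], on cyclic sequences. *)
Local Notation arc := Defs.arc.

(** * A weighted AM-GM inequality *)

Lemma weighted_AMGM (n x y : nat) :
  n.+1 * (x ^ n * y) <= n * x ^ n.+1 + y ^ n.+1.
Proof.
elim: n => [|n IHn]; first by rewrite !expnS !expn0; lia.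
(* The induction step is this inequality, (x^(n+1) - y^(n+1)) (x - y) >= 0,
   added to x times the induction hypothesis. *)
have cheb : x * y ^ n.+1 + y * x ^ n.+1 <= x * x ^ n.+1 + y * y ^ n.+1.
  have [xy|yx] := leqP x y.
    have : x ^ n.+1 <= y ^ n.+1 by rewrite leq_exp2r.
    by nia.
  have : y ^ n.+1 <= x ^ n.+1 by rewrite leq_exp2r // ltnW.
  by nia.
rewrite [x ^ n.+2]expnS [y ^ n.+2]expnS.
have := leq_mul (leqnn x) IHn.
have : x * (x ^ n * y) = x ^ n.+1 * y by rewrite expnS mulnA.
nia.
Qed.

(** * Leaves of a tree away from a given vertex *)

Section Trees.

Variables (V : finType) (e : rel V).
Hypotheses (e_sym : symmetric e) (e_irrefl : irreflexive e).

Definition induced (S : {set V}) : rel V :=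
  [rel x y | [&& e x y, x \in S & y \in S]].

Definition connected_from (S : {set V}) (v : V) : bool :=
  [forall x in S, connect (induced S) v x].

Lemma induced_connect_sym S : connect_sym (induced S).
Proof.
by apply: sym_connect_sym => x y; rewrite /induced /= e_sym (andbC (x \in S)).
Qed.

Lemma induced_connectS (S S' : {set V}) x y : S \subset S' ->
  connect (induced S) x y -> connect (induced S') x y.
Proof.
move=> /subsetP sSS'; apply: connect_sub => a b /and3P[ab aS bS].
by apply: connect1; rewrite /induced /= ab !sSS'.
Qed.

Lemma connected_from_any (S : {set V}) v w :
  w \in S -> connected_from S v -> connected_from S w.
Proof.
move=> wS /forall_inP Sv; apply/forall_inP => x xS.
by apply: connect_trans (Sv x xS); rewrite induced_connect_sym Sv.
Qed.

(** A maximal connected proper subset C of S that contains v misses exactly one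
    vertex: S has an edge from C to some z outside C, and z |: C is connected,
    so it must be the whole of S. *)
Lemma exists_noncut_vertex (S : {set V}) v :
  v \in S -> 1 < #|S| -> connected_from S v ->
  exists u, [/\ u \in S, u != v & connected_from (S :\ u) v].
Proof.
move=> vS S_gt1 /forall_inP Sv.
pose P (C : {set V}) := [&& v \in C, C \proper S & connected_from C v].
have Pv : P [set v].
  apply/and3P; split; first by rewrite inE.
    by rewrite properEcard sub1set vS cards1.
  by apply/forall_inP => x /set1P->; apply: connect0.
case: (@arg_maxnP _ _ P (fun C : {set V} => #|C|) Pv).
move=> C /and3P[vC CS Cv] Cmax.
have [sCS [y yS yC]] := properP CS.
have [x [z [xC zS zC xz]]] :
    exists x, exists z, [/\ x \in C, z \in S, z \notin C & e x z].
  have := Sv y yS; case/connectP => p.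
  elim: p v vC {vS Sv Pv Cv Cmax P} => [|a p IHp] v vC /=.
    by move=> _ yv; rewrite yv vC in yC.
  case/andP => /and3P[va vS aS] pth lst.
  have [aC|aC] := boolP (a \in C); first exact: IHp pth lst.
  by exists v, a.
have zCS : z |: C = S.
  apply/eqP; rewrite eqEproper subUset sub1set zS sCS /=.
  apply/negP => zC_proper.
  have : P (z |: C).
    apply/and3P; split=> //; first by rewrite !inE vC orbT.
    have CzC : C \subset z |: C by apply: subsetUr.
    apply/forall_inP => t; rewrite in_setU1 => /predU1P[->|tC]; last first.
      exact: induced_connectS CzC (forall_inP Cv t tC).
    apply: connect_trans (induced_connectS CzC (forall_inP Cv x xC)) _.
    by apply: connect1; rewrite /induced /= xz !inE xC eqxx orbT.
  by move/Cmax; rewrite cardsU1 zC; lia.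
exists z; split=> //; first by apply: contraNneq zC => ->.
by rewrite -zCS setU1K.
Qed.

Hypothesis e_acyclic : acyclic e.

(** Two neighbours of u joined by a path avoiding u would close up to a
    cycle. *)
Lemma noncut_vertex_neighbor_unique (S : {set V}) u v a b :
  connected_from (S :\ u) v -> a \in S -> b \in S -> e u a -> e u b -> a = b.
Proof.
move=> Sv aS bS ua ub; apply/eqP/negPn/negP => ab.
have inSu x : x \in S -> e u x -> x \in S :\ u.
  move=> xS ux; rewrite !inE xS andbT.
  by apply: contraTneq ux => ->; rewrite e_irrefl.
have := connected_from_any (inSu a aS ua) Sv.
move=> /forall_inP/(_ b (inSu b bS ub))/connectP[p0 pth0 blast].
case/shortenP: pth0 blast => p pth uniq_p _ blast.
have sub : {subset p <= S :\ u}.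
  elim: p a {ab aS ua uniq_p blast p0} pth => // c p IHp a /=.
  case/andP=> /and3P[_ _ cS] /IHp sub x; rewrite inE => /predU1P[->//|].
  exact: sub.
have epth : path e a p by apply: sub_path pth => x y /and3P[].
apply: (e_acyclic (c := u :: a :: p)).
  by case: p ab blast {pth uniq_p sub epth} => //= /eqP + ba; rewrite ba.
rewrite /ucycle /= ua rcons_path epth -blast e_sym ub /=.
rewrite inE negb_or (contraTneq _ ua) => [|<-]; last by rewrite e_irrefl.
have /= -> := uniq_p; rewrite andbT /=.
by apply/negP => /sub; rewrite !inE eqxx.
Qed.

Lemma exists_leaf_away (S : {set V}) v :
  v \in S -> 1 < #|S| -> connected_from S v ->
  exists u w, [/\ u \in S, u != v, w \in S :\ u,
                  connected_from (S :\ u) v &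
                  {in S, forall x, e u x = (x == w)}].
Proof.
move=> vS S_gt1 Sv; have [u [uS uv Suv]] := exists_noncut_vertex vS S_gt1 Sv.
have [w wS uw] : exists2 w, w \in S & e u w.
  have := forall_inP Sv u uS; rewrite induced_connect_sym => /connectP[[|w p]].
    by move=> _ /= vu; rewrite vu eqxx in uv.
  by case/andP => /and3P[uw _ wS] _ _; exists w.
exists u, w; split=> // [|x xS].
  by rewrite !inE wS andbT; apply: contraTneq uw => ->; rewrite e_irrefl.
apply/idP/eqP => [ux|->//].
exact: noncut_vertex_neighbor_unique Suv xS wS ux uw.
Qed.

End Trees.

(** * Averaging over one coordinate of a map *)

Section Resampling.

Variables (V W : finType).

Definition update (f : {ffun V -> W}) (u : V) (y : W) : {ffun V -> W} :=
  [ffun x => if x == u then y else f x].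

(** Exchanging y with the old value of f at u is an involution on the pairs
    (f, y), so choosing f and then redrawing its value at u amounts to choosing
    f, except that each map is counted #|W| times. *)
Lemma sum_resample (u : V) (F : {ffun V -> W} -> nat) :
  #|W| * \sum_f F f = \sum_f \sum_y F (update f u y).
Proof.
rewrite pair_bigA /=.
pose swap (p : {ffun V -> W} * W) := (update p.1 u p.2, p.1 u).
have swapK : involutive swap.
  case=> f y; congr (_, _); last by rewrite ffunE eqxx.
  by apply/ffunP => x; rewrite !ffunE /=; case: eqP => // ->.
rewrite (reindex_inj (inv_inj swapK)) /=.
under [RHS]eq_bigr => p _ do rewrite -[update _ _ _]/(swap (swap p)).1 swapK.
rewrite -(pair_bigA _ (fun f _ => F f)) /= big_distrr /=.
by apply: eq_bigr => f _; rewrite sum_nat_const.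
Qed.

End Resampling.

(** * Homomorphisms from stars *)

Section Degrees.

Variable H : digraph.

(** The boolean selects the direction: [true] for out-neighbours. *)
Definition neighbors (s : bool) (x : vertex H) : {set vertex H} :=
  [set y | if s then arc x y else arc y x].

Definition deg_power_sum (s : bool) (n : nat) : nat :=
  \sum_x #|neighbors s x| ^ n.

(** Once the image x of the centre is fixed, the leaves are mapped
    independently of each other into the in- or out-neighbourhood of x. *)
Lemma hom_star (a b : nat) :
  hom (star a b) H
  = \sum_x #|neighbors false x| ^ a * #|neighbors true x| ^ b.
Proof.
pose F x (o : option ('I_a + 'I_b)) : {set vertex H} :=
  match o with
  | None => [set x]
  | Some (inl _) => neighbors false x
  | Some (inr _) => neighbors true x
  end.
rewrite /hom -sum1dep_card.
rewrite (partition_big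
  (fun f : {ffun vertex (star a b) -> vertex H} => f None) predT) //=.
apply: eq_bigr => x _; rewrite sum1dep_card.
have -> : #|[set f : {ffun vertex (star a b) -> vertex H}
              | is_hom f && (f None == x)]| = #|family (F x)|.
  rewrite cardsE; apply: eq_card => f; rewrite !inE.
  apply/andP/familyP => [[/forallP hf /eqP fx] [[i|j]|] /= | Ff].
  - by have /forallP/(_ None)/implyP := hf (Some (inl i)); rewrite inE fx; apply.
  - by have /forallP/(_ (Some (inr j)))/implyP := hf None; rewrite inE fx; apply.
  - by rewrite inE fx.
  have fx : f None = x by have := Ff None; rewrite /= inE => /eqP.
  split; last by rewrite fx.
  apply/forallP => u; apply/forallP => v; apply/implyP.
  case: u v => [[i|j]|] [[i'|j']|] //= _; rewrite fx.
    by have := Ff (Some (inl i)); rewrite /= inE.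
  by have := Ff (Some (inr j')); rewrite /= inE.
rewrite card_family foldrE big_map big_enum /= (bigD1 None) //= cards1 mul1n.
rewrite (reindex_omap Some id) /=; last by case.
rewrite (eq_bigl predT) => [|o]; last by rewrite /= eqxx.
by rewrite big_sumType /= !prod_nat_const !card_ord.
Qed.

End Degrees.

(** * Counting homomorphisms by removing leaves *)

Section Counting.

Variables (T H : digraph) (e : rel (vertex T)).

Definition is_hom_on (S : {set vertex T}) (f : {ffun vertex T -> vertex H}) :=
  [forall x in S, forall y in S, arc x y ==> arc (f x) (f y)].

Hypotheses (tree_e : undirected_tree e) (ori : orientation_of e (@arc T)).

(** The only arc between the leaf u and the rest of S is the one joining it to
    w, in the direction recorded by the boolean [arc w u]; antisymmetry
    excludes the opposite arc. *)
Lemma is_hom_on_leaf (S : {set vertex T}) u w f y :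
  u \in S -> w \in S :\ u -> {in S, forall x, e u x = (x == w)} ->
  is_hom_on S (update f u y)
  = is_hom_on (S :\ u) f && (y \in neighbors (arc w u) (f w)).
Proof.
move=> uS; rewrite in_setD1 => /andP[wu wS] leaf; case: ori => eE anti.
have e_sym : symmetric e by case: tree_e.
have e_uw : arc u w || arc w u by rewrite -eE leaf.
have arc_u x : x \in S -> arc u x || arc x u -> x = w.
  by move=> xS; rewrite -eE leaf // => /eqP.
rewrite inE; apply/forall_inP/andP => [hom_f | [/forall_inP hom_f yw] a aS].
  split.
    apply/forall_inP => a /setD1P[au aS]; apply/forall_inP => b /setD1P[bu bS].
    have /forall_inP/(_ b bS) := hom_f a aS.
    by rewrite !ffunE (negPf au) (negPf bu).
  case: ifP e_uw => [wu_arc _|_ /[!orbF] uw_arc].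
    have /forall_inP/(_ u uS)/implyP/(_ wu_arc) := hom_f w wS.
    by rewrite !ffunE eqxx (negPf wu).
  have /forall_inP/(_ w wS)/implyP/(_ uw_arc) := hom_f u uS.
  by rewrite !ffunE eqxx (negPf wu).
apply/forall_inP => b bS; apply/implyP => ab; rewrite !ffunE.
have [au|au] := eqVneq a u; have [bu|bu] := eqVneq b u.
- by rewrite au bu arc_irrefl in ab.
- rewrite au in ab; have bw := arc_u b bS; rewrite ab in bw.
  rewrite (bw isT) in ab *.
  by move: yw (anti u w); rewrite ab /= => /[swap]/negPf->.
- rewrite bu in ab; have aw := arc_u a aS; rewrite ab orbT in aw.
  by rewrite (aw isT) in ab *; rewrite ab in yw.
have aSu : a \in S :\ u by rewrite !inE au.
have bSu : b \in S :\ u by rewrite !inE bu.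
exact: (implyP (forall_inP (hom_f a aSu) b bSu)).
Qed.

Definition rooted_count (S : {set vertex T}) (v : vertex T) (s : bool)
    (n : nat) :=
  \sum_(f | is_hom_on S f) #|neighbors s (f v)| ^ n.

(** Redrawing f at the leaf u turns the constraint at u into a count of the
    admissible values.  The factor at v survives since u differs from v. *)
Lemma remove_leaf (S : {set vertex T}) u v w s n :
  u \in S -> u != v -> w \in S :\ u -> {in S, forall x, e u x = (x == w)} ->
  #|vertex H| * rooted_count S v s n
  = \sum_(f | is_hom_on (S :\ u) f)
       #|neighbors s (f v)| ^ n * #|neighbors (arc w u) (f w)|.
Proof.
move=> uS uv wSu leaf; rewrite /rooted_count big_mkcond (sum_resample u) /=.
rewrite [RHS]big_mkcond; apply: eq_bigr => f _.
under eq_bigr => y _ do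
  rewrite (is_hom_on_leaf _ _ uS wSu leaf) ffunE eq_sym (negPf uv).
case: ifP => _ /=; last by rewrite big1.
by rewrite -big_mkcond /= sum_nat_const mulnC.
Qed.

(** After division by #|H| ^ #|T| the left side is the sum over the
    homomorphisms defined on S alone, so the bound does not depend on the size
    of the complement of S.  The vertex v, the direction s and the exponent n
    have to vary in the induction: AM-GM produces one term with each of the
    factors d(f v) and d'(f w), both with exponent n + 1. *)
Lemma rooted_count_le (S : {set vertex T}) v s n :
  v \in S -> connected_from e S v ->
  #|vertex H| ^ #|S| * rooted_count S v s n
  <= #|vertex H| ^ #|vertex T|
     * maxn (deg_power_sum H true (n + #|S|.-1))
            (deg_power_sum H false (n + #|S|.-1)).
Proof.
have [e_sym e_irrefl _ _ e_acyc] := tree_e.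
move: {2}(#|S|.-1) (erefl #|S|.-1) => m.
elim: m S v s n => [|m IHm] S v s n Sm vS Sv.
  have S1 : #|S| = 1 by have : 0 < #|S| by [apply/card_gt0P; exists v]; lia.
  rewrite S1 expn1 addn0.
  have -> : rooted_count S v s n =
      \sum_(f : {ffun vertex T -> vertex H}) #|neighbors s (f v)| ^ n.
    apply: eq_bigl => f; apply/forall_inP => x xS; apply/forall_inP => y yS.
    have /cards1P[z Sz] : #|S| == 1 by rewrite S1.
    move: xS yS; rewrite Sz !inE => /eqP-> /eqP->.
    by rewrite arc_irrefl.
  rewrite (sum_resample v).
  under eq_bigr => f _ do under eq_bigr => y _ do rewrite ffunE eqxx.
  rewrite sum_nat_const card_ffun leq_mul2l; apply/orP; right.
  by rewrite leq_max; case: s; rewrite leqnn ?orbT.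
have S_gt1 : 1 < #|S| by lia.
have [u [w [uS uv wSu Suv leaf]]] :=
  exists_leaf_away e_sym e_irrefl e_acyc vS S_gt1 Sv.
have Su : #|S| = #|S :\ u|.+1 by rewrite (cardsD1 u) uS.
have Sum : #|S :\ u|.-1 = m by lia.
have vSu : v \in S :\ u by rewrite !inE eq_sym uv.
rewrite Su expnSr -mulnA (remove_leaf _ _ uS uv wSu leaf).
have IHv := IHm (S :\ u) v s n.+1 Sum vSu Suv.
have IHw := IHm (S :\ u) w (arc w u) n.+1 Sum wSu
  (connected_from_any e_sym wSu Suv).
have expE : n.+1 + #|S :\ u|.-1 = n + #|S :\ u|.+1.-1.
  have : 0 < #|S :\ u| by apply/card_gt0P; exists v.
  lia.
(* Multiplying by n + 1 avoids the fractional weights of the AM-GM mean. *)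
rewrite expE in IHv IHw; rewrite -(leq_pmul2l (ltn0Sn n)).
apply: leq_trans (_ : #|vertex H| ^ #|S :\ u| *
   (n * rooted_count (S :\ u) v s n.+1
      + rooted_count (S :\ u) w (arc w u) n.+1) <= _); last by nia.
rewrite mulnCA leq_mul2l; apply/orP; right.
rewrite /rooted_count !big_distrr -big_split /=; apply: leq_sum => f _.
exact: weighted_AMGM.
Qed.

End Counting.

Theorem theorem1p1 (k : nat) (T : digraph) (hT : directed_tree T)
  (hk : #|vertex T| = k) (H : digraph) :
  hom T H <= maxn (hom (star 0 (k - 1)) H) (hom (star (k - 1) 0) H).
Proof.
have [e [tree_e ori]] := hT; have [_ _ T_gt0 T_conn _] := tree_e.
have /card_gt0P[v _] := T_gt0.
(* The factor #|H| ^ #|T| can be cancelled only when H is nonempty. *)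
have [H0|H_gt0] := posnP #|vertex H|.
  suff -> : hom T H = 0 by [].
  apply/eqP; rewrite cards_eq0; apply/eqP/setP => f; exfalso.
  by have := fintype0 (f v); apply.
have conn : connected_from e [set: vertex T] v.
  apply/forall_inP => x _; rewrite (eq_connect (e' := e)) // => a b.
  by rewrite /induced /= !inE !andbT.
have := rooted_count_le H tree_e ori true 0 (in_setT v) conn.
rewrite cardsT leq_pmul2l ?expn_gt0 ?H_gt0 // add0n hk -subn1.
have -> : rooted_count H setT v true 0 = hom T H.
  rewrite /hom -sum1dep_card; apply: eq_big => // f.
  apply/forall_inP/forallP => hom_f x.
    by apply/forallP => y; have /forall_inP := hom_f x (in_setT x); apply.
  by move=> _; apply/forall_inP => y _; apply: (forallP (hom_f x)).
move/leq_trans; apply; rewrite !hom_star /deg_power_sum.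
under [X in _ <= maxn X _]eq_bigr => x _ do rewrite expn0 mul1n.
by under [X in _ <= maxn _ X]eq_bigr => x _ do rewrite expn0 muln1.
Qed.
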